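(* Suppose $A$ and $X$ are countable. Then every set in the Borel $\sigma$-algebra $\Sigma_{\mathrm{Path}(X)}$ of the Alexandroff topology on $\mathrm{Path}(X)$ belongs to the Borel $\sigma$-algebra $\Sigma_{\mathrm{Path}(X)^\infty}$ generated by the Scott-open subsets of $\mathrm{Path}(X)^\infty$. Likewise $\Sigma_{\mathrm{Path}_\sim(X)}\subseteq\Sigma_{\mathrm{Path}_\sim(X)^\infty}$.
   Context: Fix a set $A$, $\tau\notin A$, $A_\tau=A\cup\{\tau\}$, $A_\tau^*$ finite words, $\epsilon$ the empty word, ${\downarrow}\sigma$ the set of prefixes of $\sigma$. A path on $X$ is a function $p$ into $X$ with domain ${\downarrow}\sigma$ for some $\sigma\in A_\tau^*$; $\mathrm{Path}(X)$ is ordered by $p\preceq q$ iff $\mathrm{dom}\,p\subseteq\mathrm{dom}\,q$ and $q$ agrees with $p$ on $\mathrm{dom}\,p$. The stutter basis of $p$ is the unique $\phi:\mathrm{dom}\,p\to A_\tau^*$ with $\phi(\epsilon)=\epsilon$; $\phi(\sigma'\tau)=\phi(\sigma')$ if $p(\sigma'\tau)=p(\sigma')$; $\phi(\sigma'\tau)=\phi(\sigma')\tau$ otherwise; $\phi(\sigma'a)=\phi(\sigma')a$ for $a\in A$; $\mathrm{st}(p)$ is the path with domain $\phi(\mathrm{dom}\,p)$ and $\mathrm{st}(p)\circ\phi=p$; $p\sim q$ iff $\mathrm{st}(p)=\mathrm{st}(q)$; $\mathrm{Path}_\sim(X)$ is the quotient ordered by $[p]\preceq[q]$ iff $\mathrm{st}(p)\preceq\mathrm{st}(q)$.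 Both are prefix orders. For a prefix order $Y$ with Alexandroff topology (open = upward closed), a subset $C$ is non-sober if it is downward closed, irreducible (nonempty and not a union of two smaller downward closed sets) and not of the form ${\downarrow}y$; $Y^\infty=Y\cup\{\infty_C\mid C\text{ non-sober}\}$ with order extending that of $Y$ by $\infty_C\preceq\infty_C$ and $y\preceq\infty_C$ for $y\in C$. Scott-open subsets of $Y^\infty$: upward closed $U$ such that every directed set whose supremum exists and lies in $U$ meets $U$. *)

(* Defs.v *)
From HB Require Import structures.
From mathcomp Require Import all_boot all_order.
From mathcomp Require Import boolp classical_sets functions cardinality.
From mathcomp Require Import measurable_structure.

Set Implicit Arguments.
Unset Strict Implicit.
Unset Printing Implicit Defensive.

Import Order.TTheory.

Local Open Scope classical_set_scope.
Local Open Scope order_scope.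

HB.mixin Record isPrefixOrder d T of Order.POrder d T := {
  down_comparable : forall x y z : T, x <= z -> y <= z -> x >=< y }.

#[short(type="prefixOrderType")]
HB.structure Definition PrefixOrder d :=
  {T of isPrefixOrder d T & Order.POrder d T}.

Section Alexandroff.
Context {d : Order.disp_t} {Y : porderType d}.

Definition up_closed (U : set Y) := forall x y, x <= y -> U x -> U y.

Definition down_closed (C : set Y) := forall x y, x <= y -> C y -> C x.

Definition alexandroff_open : set (set Y) := [set U | up_closed U].

(* The closed sets of the Alexandroff topology are the downward closed ones. *)
Definition irreducible (C : set Y) :=
  C !=set0 /\
  ~ exists D E : set Y, [/\ down_closed D, down_closed E,
                            D `<` C, E `<` C & C = D `|` E].

Definition nonsober (C : set Y) :=
  [/\ down_closed C, irreducible C & ~ exists y, C = [set x | x <= y]].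

Definition directed (D : set Y) :=
  D !=set0 /\ forall x y, D x -> D y -> exists z, [/\ D z, x <= z & y <= z].

Definition scott_open : set (set Y) :=
  [set U | up_closed U /\
     forall (D : set Y) (s : Y),
       directed D -> supremums D s -> U s -> D `&` U !=set0].

End Alexandroff.

Section Completion.
Context {d : Order.disp_t}.

Inductive completion (Y : prefixOrderType d) :=
| Fin of Y
| Inf of {C : set Y | nonsober C}.

Variable Y : prefixOrderType d.

HB.instance Definition _ := gen_eqMixin (completion Y).
HB.instance Definition _ := gen_choiceMixin (completion Y).

Definition completion_le (u v : completion Y) : Prop :=
  match u, v with
  | Fin x, Fin y => x <= y
  | Fin x, Inf C => sval C x
  | Inf C, Inf C' => C = C'
  | Inf _, Fin _ => False
  end.

Let le : rel (completion Y) := fun u v => `[< completion_le u v >].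

Let le_refl : reflexive le.
Proof. by case=> [y|C]; apply/asboolP => /=. Qed.

Let le_anti : antisymmetric le.
Proof.
move=> [x|C] [y|C'] /andP[/asboolP/= h1 /asboolP/= h2] //; last by rewrite h1.
by congr Fin; apply: le_anti; rewrite h1 h2.
Qed.

Let le_trans : transitive le.
Proof.
move=> [y|C] [x|C1] [z|C2] /asboolP/= h1 /asboolP/= h2; apply/asboolP => //=.
- exact: le_trans h1 h2.
- by case: C2 h2 => C2 [dC ? ?] /= h2; exact: dC h1 h2.
- by rewrite -h2.
- by rewrite h1.
Qed.

HB.instance Definition _ :=
  Order.Le_isPOrder.Build d (completion Y) le_refl le_anti le_trans.

Lemma completion_leE (u v : completion Y) : (u <= v) = `[< completion_le u v >].
Proof. by []. Qed.

End Completion.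

Arguments Fin {d Y}.
Arguments Inf {d Y}.

(* [None] plays the role of tau; {classic A} only provides decidable equality
   on the arbitrary type A. *)
Definition word (A : Type) : Type := seq (option {classic A}).

Notation tau := (@None {classic _}).

Section Paths.
Variables A X : Type.
Implicit Types s w : word A.

Definition down_word (sigma : word A) : set (word A) := [set s | prefix s sigma].

Definition pdom (f : word A -> option X) : set (word A) := [set s | isSome (f s)].

(* A path is encoded by its graph as a partial function on words, so that
   equality of paths is equality of functions with the same domain. *)
Definition Path : Type :=
  {f : word A -> option X | exists sigma, pdom f = down_word sigma}.

HB.instance Definition _ := gen_eqMixin Path.
HB.instance Definition _ := gen_choiceMixin Path.

Definition path_fun (p : Path) : word A -> option X := sval p.
Coercion path_fun : Path >-> Funclass.

Definition path_le (p q : Path) : Prop :=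
  pdom p `<=` pdom q /\ forall s, pdom p s -> q s = p s.

Lemma path_ext (p q : Path) : p =1 q -> p = q.
Proof.
case: p q => [f pf] [g pg] /funext/= h; move: pg; rewrite -h => pg.
by rewrite (Prop_irrelevance pf pg).
Qed.

Let le : rel Path := fun p q => `[< path_le p q >].

Let le_refl : reflexive le.
Proof. by move=> p; apply/asboolP; split. Qed.

Let le_anti : antisymmetric le.
Proof.
move=> p q /andP[/asboolP[pq epq] /asboolP[qp eqp]]; apply: path_ext => s.
case E: (isSome (p s)); first by rewrite epq.
case F: (isSome (q s)); first by rewrite eqp.
by case: (p s) (q s) E F => [?|] [?|].
Qed.

Let le_trans : transitive le.
Proof.
move=> q p r /asboolP[pq epq] /asboolP[qr eqr]; apply/asboolP; split.
  exact: subset_trans pq qr.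
by move=> s ps; rewrite eqr ?epq//; exact: pq.
Qed.

Fact path_display : Order.disp_t. Proof. exact: Order.Disp tt tt. Qed.

HB.instance Definition _ :=
  Order.Le_isPOrder.Build path_display Path le_refl le_anti le_trans.

Lemma path_leE (p q : Path) : (p <= q) = `[< path_le p q >].
Proof. by []. Qed.

Lemma prefix_total (s t w : word A) :
  prefix s w -> prefix t w -> prefix s t \/ prefix t s.
Proof.
move=> /prefixP[u ->]; rewrite prefixE => /eqP.
have [le_ts|/ltnW le_st] := leqP (size t) (size s).
  rewrite takel_cat// => ts; right.
  by apply/prefixP; exists (drop (size t) s); rewrite -{1}ts cat_take_drop.
by rewrite take_cat ltnNge le_st /= => <-; left; exact: prefix_prefix.
Qed.

Lemma pathP (p : Path) : exists sigma, pdom p = down_word sigma.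
Proof. exact: svalP p. Qed.

Let path_down_comparable (p q r : Path) : p <= r -> q <= r -> p >=< q.
Proof.
move=> /asboolP[pr epr] /asboolP[qr eqr].
have [sp dp] := pathP p; have [sq dq] := pathP q; have [sr dr] := pathP r.
have psr : prefix sp sr.
  suff : down_word sr sp by [].
  by rewrite -dr; apply: pr; rewrite dp; exact: prefix_refl.
have qsr : prefix sq sr.
  suff : down_word sr sq by [].
  by rewrite -dr; apply: qr; rewrite dq; exact: prefix_refl.
have [pq|qp] := prefix_total psr qsr; apply/orP; [left|right].
  have sub : pdom p `<=` pdom q.
    rewrite dp dq => s /= ss; exact: prefix_trans ss pq.
  by apply/asboolP; split=> // s ps; rewrite -epr// eqr//; exact: sub.
have sub : pdom q `<=` pdom p.
  rewrite dp dq => s /= ss; exact: prefix_trans ss qp.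
by apply/asboolP; split=> // s ps; rewrite -eqr// epr//; exact: sub.
Qed.

HB.instance Definition _ :=
  isPrefixOrder.Build path_display Path path_down_comparable.

(* Only the values of phi on the domain of p are constrained. *)
Definition is_stutter_basis (p : Path) (phi : word A -> word A) : Prop :=
  [/\ phi [::] = [::],
      forall s, pdom p (rcons s tau) -> p (rcons s tau) = p s ->
        phi (rcons s tau) = phi s,
      forall s, pdom p (rcons s tau) -> p (rcons s tau) <> p s ->
        phi (rcons s tau) = rcons (phi s) tau &
      forall s (a : A), pdom p (rcons s (Some a)) ->
        phi (rcons s (Some a)) = rcons (phi s) (Some a)].

Definition is_st (p q : Path) : Prop :=
  exists2 phi, is_stutter_basis p phi &
    pdom q = phi @` pdom p /\ forall s, pdom p s -> q (phi s) = p s.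

Let Fixpoint basis_rev (f : word A -> option X) (r : word A) : word A :=
  match r with
  | [::] => [::]
  | None :: r' => if `[< f (rev r) = f (rev r') >] then basis_rev f r'
                  else rcons (basis_rev f r') tau
  | Some a :: r' => rcons (basis_rev f r') (Some a)
  end.

Let basis f (s : word A) := basis_rev f (rev s).

Let basisP (p : Path) : is_stutter_basis p (basis p).
Proof.
split=> //.
- move=> s _ e; rewrite /basis rev_rcons /= ifT//; apply/asboolP.
  by rewrite -rev_rcons !revK.
- move=> s _ e; rewrite /basis rev_rcons /= ifF//; apply/asboolP.
  by rewrite -rev_rcons !revK.
- by move=> s a _; rewrite /basis rev_rcons.
Qed.

Lemma stutter_basis_exists (p : Path) : exists phi, is_stutter_basis p phi.
Proof. by exists (basis p). Qed.

Lemma pdom_rcons (p : Path) s x : pdom p (rcons s x) -> pdom p s.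
Proof.
have [sp dp] := pathP p; rewrite dp /down_word /=.
by apply: prefix_trans; exact: prefix_rcons.
Qed.

Lemma stutter_basis_unique (p : Path) phi psi :
  is_stutter_basis p phi -> is_stutter_basis p psi ->
  forall s, pdom p s -> phi s = psi s.
Proof.
move=> [f0 f1 f2 f3] [g0 g1 g2 g3]; elim/last_ind => [|s [a|] IH] ps.
- by rewrite f0 g0.
- by rewrite f3// g3// IH//; exact: pdom_rcons ps.
- have [e|ne] := pselect (p (rcons s tau) = p s).
    by rewrite f1// g1// IH//; exact: pdom_rcons ps.
  by rewrite f2// g2// IH//; exact: pdom_rcons ps.
Qed.

Lemma down_word0 : down_word [::] = [set [::]].
Proof.
apply/seteqP; split=> [s|s ->]; last exact: prefix_refl.
by rewrite /down_word/= => h; move: h; case: s.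
Qed.

Lemma down_word_rcons s x :
  down_word (rcons s x) = down_word s `|` [set rcons s x].
Proof.
apply/seteqP; split=> w; last first.
  case=> [ws|->]; last exact: prefix_refl.
  exact: prefix_trans ws (prefix_rcons _ _).
move=> /prefixP[u]; case/lastP: u => [|u y]; first by rewrite cats0; right.
by rewrite -rcons_cat => /rcons_inj[-> _]; left; exact: prefix_prefix.
Qed.

Lemma st_exists (p : Path) : exists q, is_st p q.
Proof.
have [phi pphi] := stutter_basis_exists p.
have [sp dp] := pathP p.
have [f0 f1 f2 f3] := pphi.
suff [f df [im fE]] : exists2 f : word A -> option X,
    pdom f = down_word (phi sp) &
    down_word (phi sp) = phi @` down_word sp /\
    forall s, down_word sp s -> f (phi s) = p s.
  have df' : exists sigma, pdom f = down_word sigma by exists (phi sp).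
  by exists (exist _ f df'), phi => //; split; rewrite dp// -im.
have : pdom p sp by rewrite dp; exact: prefix_refl.
elim/last_ind: (sp) => {dp} [|s x IH] ps.
  exists (fun w => if w == [::] then p [::] else None).
    rewrite f0 down_word0; apply/seteqP; split=> w; rewrite /pdom/=.
      by case: eqP.
    by move=> ->; rewrite eqxx.
  rewrite f0 down_word0 image_set1 f0; split=> // s ->.
  by rewrite f0 eqxx.
have [f df [im fE]] := IH (pdom_rcons ps).
have dss : down_word s s by exact: prefix_refl.
have [[e e']|e] : (phi (rcons s x) = phi s /\ p (rcons s x) = p s) \/
         phi (rcons s x) = rcons (phi s) x.
- case: x ps => [a|] ps; first by right; exact: f3.
  have [e|ne] := pselect (p (rcons s tau) = p s); last by right; exact: f2.
  by left; split=> //; exact: f1.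
- exists f; rewrite e//; rewrite down_word_rcons image_setU image_set1 -im e.
  split; last by move=> t [|->]; [exact: fE|rewrite e e' fE].
  by rewrite setUidl// => _ ->; exact: prefix_refl.
have small (t : word A) : down_word (phi s) t -> (t == rcons (phi s) x) = false.
  by move=> /size_prefix sz; apply/eqP => h; move: sz; rewrite h size_rcons ltnn.
have imP (t : word A) : down_word s t -> down_word (phi s) (phi t).
  by move=> ts; rewrite im; exists t.
exists (fun w => if w == rcons (phi s) x then p (rcons s x) else f w).
  rewrite e down_word_rcons -df; apply/seteqP; split=> w; rewrite /pdom/=.
    by case: eqP => [->|_]; [right|left].
  case=> [fw|->]; last by rewrite eqxx.
  by rewrite small// -df.
rewrite !(e, down_word_rcons) image_setU image_set1 -im e; split=> // t.
by case=> [ts|->]; [rewrite small ?fE//; exact: imP|rewrite e eqxx].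
Qed.

Lemma st_unique (p q r : Path) : is_st p q -> is_st p r -> q = r.
Proof.
move=> [f fp [dq qE]] [g gp [dr rE]].
have fg := stutter_basis_unique fp gp.
have dqr : pdom q = pdom r by rewrite dq dr; exact: eq_imagel.
apply: path_ext => w; have [qw|nqw] := pselect (pdom q w).
  by move: (qw); rewrite dq => -[s ps <-]; rewrite qE// fg// rE.
have nrw : ~ pdom r w by rewrite -dqr.
by move: nqw nrw; rewrite /pdom /=; case: (q w) (r w) => [?|] [?|] // [].
Qed.

Definition st (p : Path) : Path := sval (cid (st_exists p)).

Lemma stP (p : Path) : is_st p (st p).
Proof. exact: svalP (cid (st_exists p)). Qed.

Definition stutter_equiv : rel Path := fun p q => st p == st q.

Let stutter_refl : reflexive stutter_equiv.
Proof. by move=> p; exact: eqxx. Qed.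

Let stutter_sym : symmetric stutter_equiv.
Proof. by move=> p q; exact: eq_sym. Qed.

Let stutter_trans : transitive stutter_equiv.
Proof. by move=> q p r /eqP pq /eqP qr; apply/eqP; rewrite pq. Qed.

Canonical stutter_equiv_rel :=
  EquivRel stutter_equiv stutter_refl stutter_sym stutter_trans.

Definition QPath : Type := {eq_quot stutter_equiv}%qT.

HB.instance Definition _ := Choice.on QPath.
HB.instance Definition _ := EqQuotient.on QPath.

Let qle : rel QPath := fun P Q => st (repr P) <= st (repr Q).

Let st_repr (P Q : QPath) : st (repr P) = st (repr Q) -> P = Q.
Proof.
by move=> h; rewrite -(reprK P) -(reprK Q); apply/eqmodP; apply/eqP.
Qed.

Let qle_refl : reflexive qle.
Proof. by move=> P; exact: lexx. Qed.

Let qle_anti : antisymmetric qle.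
Proof. by move=> P Q h; apply: st_repr; apply: Order.POrderTheory.le_anti. Qed.

Let qle_trans : transitive qle.
Proof. by move=> Q P R; exact: Order.POrderTheory.le_trans. Qed.

Fact qpath_display : Order.disp_t. Proof. exact: Order.Disp tt tt. Qed.

HB.instance Definition _ :=
  Order.Le_isPOrder.Build qpath_display QPath qle_refl qle_anti qle_trans.

Let qpath_down_comparable (P Q R : QPath) : P <= R -> Q <= R -> P >=< Q.
Proof. exact: down_comparable. Qed.

HB.instance Definition _ :=
  isPrefixOrder.Build qpath_display QPath qpath_down_comparable.

Lemma st_pi (p : Path) : st (repr (\pi_QPath p)%qT) = st p.
Proof. by apply/eqP; have /eqmodP := reprK (\pi_QPath p)%qT. Qed.

Lemma qpath_lePi (p q : Path) :
  (\pi_QPath p <= \pi_QPath q)%qT = (st p <= st q).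
Proof. by rewrite -(st_pi p) -(st_pi q). Qed.

End Paths.

(* Main.v *)
Require Import Defs.
From mathcomp Require Import all_boot all_order.
From mathcomp Require Import boolp classical_sets functions cardinality.
From mathcomp Require Import measurable_structure.

(** In both prefix orders only finitely many elements lie below a given one, as
    witnessed by a strictly monotone map to [nat]. Hence a directed set whose
    supremum is a finite point contains it, and an upper set [U] of the
    completion is Scott open as soon as, for every infinite point [Inf C] of [U],
    some [x] in [C] has [Fin x] in [U]. This applies to both
    [{u | Fin x <= u}] and [{u | Fin x < u}], the latter because [C] is not the
    down-set of [x]; their difference is [{Fin x}]. There are countably many
    paths, so every set of finite points is a countable union of such
    singletons. *)

Set Implicit Arguments.
Unset Strict Implicit.
Unset Printing Implicit Defensive.

Import Order.TTheory.

Local Open Scope classical_set_scope.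

Section PrefixOrder.
Local Open Scope order_scope.
Context {d : Order.disp_t} {Y : prefixOrderType d}.
Implicit Types (x y : Y) (U D : set (completion Y)).

(** If [x] and [y] had no common upper bound in [C], then [C] would be the union of what remains
    after removing the up-set of [x] and what remains after removing that of [y]. *)
Lemma irreducible_directed (C : set Y) :
  down_closed C -> irreducible C -> directed C.
Proof.
move=> dC [C0 irrC]; split=> // x y Cx Cy; apply: contrapT => noz; apply: irrC.
have proper z : C z -> C `\` [set t | z <= t] `<` C.
  by move=> Cz; split; [exact: subDsetl|move=> /(_ z Cz)[_]; apply; exact: lexx].
have down z : down_closed (C `\` [set t | z <= t]).
  move=> s t st [Ct nzt]; split; first exact: dC st Ct.
  by move=> zs; apply: nzt; exact: le_trans zs st.
exists (C `\` [set t | x <= t]), (C `\` [set t | y <= t]); split.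
- exact: down.
- exact: down.
- exact: proper.
- exact: proper.
- apply/seteqP; split=> [z Cz|z [[]|[]]//].
  have [xz|nxz] := pselect (x <= z); last by left.
  by right; split=> // yz; apply: noz; exists z.
Qed.

(** A common upper bound in [C] suffices, since down-sets of a prefix order are chains. *)
Lemma nonsober_comparable (C : set Y) x y : nonsober C -> C x -> C y -> x >=< y.
Proof.
move=> [dC irrC _] Cx Cy.
have [_ /(_ x y Cx Cy)[z [_ xz yz]]] := irreducible_directed dC irrC.
exact: down_comparable xz yz.
Qed.

Variable rank : Y -> nat.
Hypothesis rank_lt : forall x y, x < y -> (rank x < rank y)%N.

(** Everything below [Fin x] is finite of rank at most [rank x], so [D] has an element of maximal
    rank; nothing in [D] is strictly above it, and directedness makes it greatest. *)
Lemma directed_below_fin_max D x :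
  directed D -> ubound D (Fin x) -> exists2 m, D m & ubound D m.
Proof.
move=> [[u Du] dirD] Dx.
pose P n := `[< exists2 y, D (Fin y) & rank y = n >].
have finD v : D v -> exists y, v = Fin y.
  by move=> Dv; move: (Dx v Dv); case: v Dv => [y _ _|C _ /asboolP//]; exists y.
have exP : exists n, P n.
  by have [y uy] := finD u Du; exists (rank y); apply/asboolP; exists y; rewrite -?uy.
have boundP n : P n -> (n <= rank x)%N.
  move=> /asboolP[y Dy <-]; have /asboolP/= := Dx _ Dy.
  by rewrite le_eqVlt => /orP[/eqP->//|/rank_lt/ltnW].
have [n /asboolP[y Dy <-] maxn] := ex_maxnP exP boundP.
exists (Fin y) => // v Dv; have [w [Dw yw vw]] := dirD _ _ Dy Dv.
have [z wz] := finD w Dw; subst w.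
move/asboolP: yw => /=; rewrite [y <= z]le_eqVlt => /orP[/eqP->//|/rank_lt].
by rewrite ltnNge maxn//; apply/asboolP; exists z.
Qed.

Lemma scott_openI U : up_closed U ->
  (forall C, U (Inf C) -> exists2 x, sval C x & U (Fin x)) -> scott_open U.
Proof.
move=> upU UInf; split=> // D [x|C] dirD [ubD lubD] Us.
  have [m Dm ubm] := directed_below_fin_max dirD ubD.
  by exists m; split=> //; exact: upU (lubD m ubm) Us.
have [x Cx Ux] := UInf C Us; apply: contrapT => DU.
(* If [D] misses [U], its elements are finite points of the chain [C] not above [x], hence below
   [x]; the supremum [Inf C] would then lie below [Fin x]. *)
suff : ubound D (Fin x) by move=> /lubD/asboolP.
move=> v Dv; have := ubD v Dv; case: v Dv => [y|C'] Dv /asboolP/= vC; last first.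
  by exfalso; apply: DU; exists (Inf C'); rewrite vC in Dv *.
have /orP[xy|yx] := nonsober_comparable (svalP C) Cx vC; last exact/asboolP.
exfalso; apply: DU; exists (Fin y); split=> //.
by apply: (upU (Fin x)) => //; exact/asboolP.
Qed.

Lemma scott_open_ge x : scott_open [set u | Fin x <= u].
Proof.
apply: scott_openI => [u v uv /= xu|C /asboolP/= Cx]; first exact: le_trans uv.
by exists x => //=; exact: lexx.
Qed.

Lemma scott_open_gt x : scott_open [set u | Fin x < u].
Proof.
apply: scott_openI => [u v uv /= xu|C /= /ltW/asboolP/= Cx].
  exact: lt_le_trans uv.
have [dC irrC sober] := svalP C.
have [y Cy nyx] : exists2 y, sval C y & ~ y <= x.
  apply: contrapT => noy; apply: sober; exists x; apply/seteqP; split=> y /=.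
    by move=> Cy; apply: contrapT => nyx; apply: noy; exists y.
  by move=> yx; exact: dC yx Cx.
exists y => //; have /orP[xy|//] := nonsober_comparable (svalP C) Cx Cy.
rewrite lt_neqAle; apply/andP; split; last exact/asboolP.
by apply/eqP => -[xy']; apply: nyx; rewrite xy'.
Qed.

Lemma measurable_fin1 x : <<s @scott_open _ (completion Y) >> [set Fin x].
Proof.
have -> : [set Fin x] =
    (~` (~` [set u | Fin x <= u] `|` [set u | Fin x < u]))%classic.
  rewrite setCU setCK; apply/seteqP; split=> [_ ->|u [/= xu /negP]].
    by split=> /=; [exact: lexx|rewrite ltxx].
  by rewrite lt_neqAle xu andbT negbK => /eqP.
rewrite -!setTD; apply: sigma_algebraCD.
(* The binary union becomes a sequence of sets that are empty from index 2 on. *)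
rewrite -bigcup2E; apply: sigma_algebra_bigcup => -[|[|n]] /=.
- apply: sigma_algebraCD; apply: sub_sigma_algebra; exact: scott_open_ge.
- apply: sub_sigma_algebra; exact: scott_open_gt.
- exact: sigma_algebra0.
Qed.

Lemma measurable_fin (B : set Y) : countable [set: Y] ->
  <<s @scott_open _ (completion Y) >> (Fin @` B).
Proof.
move=> /countable_injP[f injf].
(* The fibres of the injection [f] cut [B] into slices with at most one point each. *)
have -> : Fin @` B = \bigcup_n (Fin @` (B `&` f @^-1` [set n])).
  by rewrite -image_bigcup -setI_bigcupr -preimage_bigcup bigcup_imset1 image_id
             preimage_setT setIT.
apply: sigma_algebra_bigcup => n.
have [[x [Bx fx]]|nB] := pselect ((B `&` f @^-1` [set n]) !=set0).
  rewrite (_ : (_ `&` _)%classic = [set x]) ?image_set1; first exact: measurable_fin1.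
  apply/seteqP; split=> [y [_ fy]|_ ->//]; apply: injf; rewrite ?inE//.
  by rewrite fy fx.
rewrite (_ : (_ `&` _)%classic = set0) ?image_set0; first exact: sigma_algebra0.
by apply/eqP; apply: contrapT => /negP/set0P.
Qed.

End PrefixOrder.

Section PathCountable.
Context {A X : Type}.
Implicit Types p q : Path A X.

Definition tip p : word A := sval (cid (Defs.pathP p)).

Lemma pdom_tip p : pdom p = down_word (tip p).
Proof. exact: svalP (cid (Defs.pathP p)). Qed.

Definition path_rank p : nat := size (tip p).

Lemma path_rank_lt p q : (p < q)%O -> (path_rank p < path_rank q)%N.
Proof.
move=> pq; have /asboolP[sub eqpq] := ltW pq.
have pre : prefix (tip p) (tip q).
  suff : down_word (tip q) (tip p) by [].
  by rewrite -pdom_tip; apply: sub; rewrite pdom_tip; exact: prefix_refl.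
rewrite ltn_neqAle size_prefix// andbT; apply/eqP => eqsz.
have eqtip : tip p = tip q.
  by move: pre; rewrite prefixE [size (tip p)]eqsz take_size => /eqP.
(* Equal tips mean equal domains, so the agreement of [p] and [q] on the domain of [p] is
   symmetric. *)
suff qp : (q <= p)%O by move: (lt_le_trans pq qp); rewrite ltxx.
apply/asboolP; rewrite /Defs.path_le !pdom_tip eqtip; split=> // s qs.
by rewrite eqpq// pdom_tip eqtip.
Qed.

Lemma countable_path :
  countable [set: A] -> countable [set: X] -> countable [set: Path A X].
Proof.
move=> /countable_injP[f injf] /countable_injP[g injg].
have injof : injective (omap f).
  by case=> [a|] [b|] //= [] /injf ->//; rewrite inE.
have injog : injective (omap g).
  by case=> [a|] [b|] //= [] /injg ->//; rewrite inE.
(* A path is determined by its tip and its values along all prefixes of the tip; the successor in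
   [iota] includes the tip itself. *)
pose code p := (map (omap f) (tip p),
  [seq omap g (p (take i (tip p))) | i <- iota 0 (size (tip p)).+1]).
apply/countable_injP; exists (pickle \o code) => p q _ _ /=.
move=> /(pcan_inj pickleK) eqcode.
have eqtip : tip p = tip q by exact: inj_map injof _ _ (congr1 fst eqcode).
have := congr1 snd eqcode; rewrite /snd /code -eqtip.
move=> /eq_in_map eqval; apply: path_ext => s.
have [ps|nps] := pselect (pdom p s); last first.
  have nqs : ~ pdom q s by rewrite pdom_tip -eqtip -pdom_tip.
  by move: nps nqs; rewrite /pdom/=; case: (p s) (q s) => [?|] [?|] // [].
move: ps; rewrite pdom_tip /= /down_word /= => ps.
(* The value at a prefix [s] of the tip is the list entry of index [size s]. *)
have /eqP <- : take (size s) (tip p) == s by rewrite -prefixE.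
apply: injog; apply: eqval.
by rewrite mem_iota add0n ltnS size_prefix.
Qed.

Lemma countable_qpath :
  countable [set: A] -> countable [set: X] -> countable [set: QPath A X].
Proof.
move=> cA cX; have /countable_injP[f injf] := countable_path cA cX.
apply/countable_injP; exists (f \o repr) => P Q _ _ /= /injf eqPQ.
by rewrite -(reprK P) -(reprK Q) eqPQ ?inE.
Qed.

Lemma qpath_rank_lt (P Q : QPath A X) : (P < Q)%O ->
  (path_rank (st (repr P)) < path_rank (st (repr Q)))%N.
Proof.
(* Expressed by [<=] alone, strictness passes from classes to their images under [st] by definition
   of the quotient order. *)
move=> PQ; apply: path_rank_lt; rewrite lt_leAnge.
by move: PQ; rewrite lt_leAnge.
Qed.

End PathCountable.

Theorem theorem39 (A X : Type)
    (cA : countable [set: A]) (cX : countable [set: X]) :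
  (forall B : set (Path A X),
      <<s @alexandroff_open _ (Path A X) >> B ->
      <<s @scott_open _ (completion (Path A X)) >> (Fin @` B)) /\
  (forall B : set (QPath A X),
      <<s @alexandroff_open _ (QPath A X) >> B ->
      <<s @scott_open _ (completion (QPath A X)) >> (Fin @` B)).
Proof.
split=> B _.
- exact (measurable_fin (@path_rank_lt A X) B (countable_path cA cX)).
- exact (measurable_fin (@qpath_rank_lt A X) B (countable_qpath cA cX)).
Qed.
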